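(* Let $0<\delta<4$ and $C>0$, and let $k^*(t)=\dfrac{C}{(1+|t|)^{2+\delta/2}}$. Let $h>0$ be the solution of $h''(t)=k^*(t)h(t)$, $h(0)=1$, $h'(0)=0$. Let $(\mathcal M,g)$ be the geodesically complete, simply connected two-dimensional Riemannian manifold with non-positive Gauss curvature $K=-k^*(t)$ which has global geodesic coordinates $(x,t)$ and metric $g=dt^2+h(t)^2\,dx^2$. Let $T_1>0$ be sufficiently large, let $T_2>T_1$ be arbitrary, and put $\Omega=[T_1,T_2]\times\mathbb R=\{(t,x): T_1\le t\le T_2,\ x\in\mathbb R\}$. Then there exist a symmetric matrix field $(h_{ij})\in L^\infty_{loc}(\Omega)$ satisfying the Gauss--Codazzi equations of $g$ in $\mathcal D'(\Omega)$, and a mapping $\mathbf y\in W^{2,\infty}_{loc}(\Omega;\mathbb R^3)$, such that, with $(x_1,x_2)=(x,t)$, $$g_{ij}=\partial_i\mathbf y\cdot\partial_j\mathbf y,\qquad h_{ij}=\partial_{ij}\mathbf y\cdot\frac{\partial_1\mathbf y\times\partial_2\mathbf y}{|\partial_1\mathbf y\times\partial_2\mathbf y|}\qquad\text{a.e. in }\Omega,\quad i,j=1,2.$$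
   Context: Coordinates are $(x_1,x_2)=(x,t)$, $\partial_1=\partial_x$, $\partial_2=\partial_t$, so $g_{11}=h(t)^2$, $g_{12}=g_{21}=0$, $g_{22}=1$. The function $h=h(t)$ (no index) is the coefficient in the metric and $(h_{ij})$ (two indices) are the coefficients of the second fundamental form. The Gauss--Codazzi equations for $(h_{ij})$ are, in the sense of distributions, $$\partial_t h_{11}-\partial_x h_{12}=h_{11}\frac{h'}{h}+h_{22}\,h\,h',\qquad \partial_t h_{12}-\partial_x h_{22}=-h_{12}\frac{h'}{h},\qquad h_{11}h_{22}-h_{12}^2=-k^*h^2 .$$ Statements in $\mathcal D'(\Omega)$ and local spaces on $\Omega$ refer to the interior of $\Omega$. *)

(* Defs.v *)
From mathcomp Require Import all_boot all_order all_algebra.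
From mathcomp Require Import all_classical all_reals all_analysis.

Set Implicit Arguments.
Unset Strict Implicit.
Unset Printing Implicit Defensive.

Import Order.TTheory GRing.Theory Num.Theory.
Import numFieldNormedType.Exports.

Local Open Scope ring_scope.
Local Open Scope classical_set_scope.

(* A point is p = (x, t), so p.1 = x = x_1 and p.2 = t = x_2.  The mathematical
   indices 1, 2 are the ordinals 0, 1 : 'I_2. *)
Notation plane R := (R * R)%type.

Section Distributions.
Context {R : realType}.

Definition lebesgue2 :=
  (@lebesgue_measure R \x @lebesgue_measure R)%E.

Definition axis (i : 'I_2) : plane R := if i == 0 then (1, 0) else (0, 1).

Definition partial (i : 'I_2) (f : plane R -> R) : plane R -> R :=
  fun p => 'D_(axis i) f p.

(* C^oo: every iterated partial derivative exists and is Frechet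
   differentiable everywhere. *)
Definition smooth (f : plane R -> R) :=
  forall (s : seq 'I_2) (p : plane R), differentiable (foldr partial f s) p.

Definition supp (f : plane R -> R) : set (plane R) :=
  closure [set p | f p != 0].

Definition test_function (U : set (plane R)) (phi : plane R -> R) :=
  [/\ smooth phi, compact (supp phi) & supp phi `<=` U].

(* Distributions are represented by their values on test functions; they are
   compared on U only through [eq_distr], hence only on test functions. *)
Definition distr := (plane R -> R) -> R.

Definition eq_distr (U : set (plane R)) (S T : distr) :=
  forall phi, test_function U phi -> S phi = T phi.

Definition of_fun (U : set (plane R)) (u : plane R -> R) : distr :=
  fun phi => \int[lebesgue2]_(p in U) (u p * phi p).

Definition dpartial (i : 'I_2) (T : distr) : distr :=
  fun phi => - T (partial i phi).

Definition dsub (S T : distr) : distr := fun phi => S phi - T phi.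

Definition weak_partial (U : set (plane R)) (i : 'I_2) (u v : plane R -> R) :=
  eq_distr U (dpartial i (of_fun U u)) (of_fun U v).

Definition Linfty_loc (U : set (plane R)) (u : plane R -> R) :=
  forall K, compact K -> K `<=` U -> u \_ K \in Lfun lebesgue2 +oo%E.

(* y belongs to W^{2,oo}_loc(U; R^3), with weak first derivatives
   D i = d_i y and weak second derivatives D2 i j = d_i d_j y. *)
Definition W2infty_loc (U : set (plane R)) (y : plane R -> 'rV[R]_3)
    (D : 'I_2 -> plane R -> 'rV[R]_3)
    (D2 : 'I_2 -> 'I_2 -> plane R -> 'rV[R]_3) :=
  forall k : 'I_3,
  [/\ Linfty_loc U (fun p => y p 0 k),
      forall i, Linfty_loc U (fun p => D i p 0 k),
      forall i j, Linfty_loc U (fun p => D2 i j p 0 k),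
      forall i, weak_partial U i (fun p => y p 0 k) (fun p => D i p 0 k) &
      forall i j,
        weak_partial U i (fun p => D j p 0 k) (fun p => D2 i j p 0 k)].

End Distributions.

Section Euclidean3.
Context {R : realType}.
Implicit Types u v : 'rV[R]_3.

Definition dot3 u v : R := \sum_k u 0 k * v 0 k.

(* The library norm on 'rV[R]_3 is the sup norm. *)
Definition enorm3 u : R := Num.sqrt (dot3 u u).

Definition cross3 u v : 'rV[R]_3 :=
  \row_k (u 0 (k + 1) * v 0 (k + 2%:R) - u 0 (k + 2%:R) * v 0 (k + 1)).

End Euclidean3.

Section Surface.
Context {R : realType}.

Definition kstar (delta C : R) (t : R) : R :=
  C / (1 + `|t|) `^ (2 + delta / 2).

Definition metric_ode (k h : R -> R) :=
  [/\ forall t, derivable h t 1, forall t, derivable h^`() t 1,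
      forall t, h^`()^`() t = k t * h t, h 0 = 1 & h^`() 0 = 0].

(* The metric dt^2 + h(t)^2 dx^2 in the coordinates (x_1, x_2) = (x, t). *)
Definition metric (h : R -> R) (p : plane R) : 'M[R]_2 :=
  \matrix_(i, j) if i != j then 0 else if i == 0 then h p.2 ^+ 2 else 1.

Definition Omega (T1 T2 : R) : set (plane R) := [set p | T1 <= p.2 <= T2].

(* The Gauss-Codazzi system of [metric h], of Gauss curvature -k,
   in D'(U). *)
Definition Gauss_Codazzi (U : set (plane R)) (k h : R -> R)
    (b : plane R -> 'M[R]_2) :=
  let b11 p := b p 0 0 in
  let b12 p := b p 0 1 in
  let b22 p := b p 1 1 in
  let h' := h^`() in
  [/\ eq_distr U
        (dsub (dpartial 1 (of_fun U b11)) (dpartial 0 (of_fun U b12)))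
        (of_fun U (fun p =>
           b11 p * (h' p.2 / h p.2) + b22 p * h p.2 * h' p.2)),
      eq_distr U
        (dsub (dpartial 1 (of_fun U b12)) (dpartial 0 (of_fun U b22)))
        (of_fun U (fun p => - b12 p * (h' p.2 / h p.2))) &
      eq_distr U
        (of_fun U (fun p => b11 p * b22 p - b12 p ^+ 2))
        (of_fun U (fun p => - k p.2 * h p.2 ^+ 2))].

Definition unit_normal (u v : 'rV[R]_3) : 'rV[R]_3 :=
  (enorm3 (cross3 u v))^-1 *: cross3 u v.

End Surface.

(* Main.v *)
Require Import Defs.
From mathcomp Require Import all_boot all_order all_algebra.
From mathcomp Require Import all_classical all_reals all_analysis.
From mathcomp Require Import ess_sup_inf measurable_realfun.
From mathcomp Require Import ring lra.

Import Order.TTheory GRing.Theory Num.Theory.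
Import numFieldNormedType.Exports.

Local Open Scope ring_scope.
Local Open Scope classical_set_scope.

(** The immersion is a surface of revolution, or rather the universal cover of
one.  For a number a > 0 consider
<<
  y(x, t) = (a h(t) cos (x / a), a h(t) sin (x / a), z(t)).
>>
The circles t = const have speed |d_x y| = h(t) whatever a is, while
|d_t y|^2 = a^2 h'^2 + z'^2, so y is isometric as soon as
z' = zeta := sqrt (1 - a^2 h'^2).  This makes sense, and zeta stays away from
zero, when a |h'| < 1.  On the strip T_1 <= t <= T_2 the function h' is bounded,
and the period 2 pi a of the parametrisation is free because x ranges over a
line, so a sufficiently small a does the job.

The unit normal is (zeta cos (x / a), zeta sin (x / a), - a h'), and the second
fundamental form is diagonal with entries - h zeta / a and a h'' / zeta
([surf_fundamental_forms]).  Their product is - h h'' = - k h^2, which is the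
Gauss equation; since the entries depend on t only, the Codazzi equations reduce
to zeta' = - a^2 h' h'' / zeta ([Gauss_Codazzi_fundamental2]).

As h'' = k h is continuous, y has continuous derivatives up to order two, and
all the weak derivatives are classical ones.  The bridge is
[weak_partial_of_partial]: on an open set a classical partial derivative is a
weak one as soon as the function and this single partial derivative are
continuous.  In this form it applies to a h'' / zeta in the direction of x
without any differentiability in t. *)

(** * Lebesgue measure and continuous functions on the plane *)

Section Analysis.
Context {R : realType}.
Implicit Types (U K : set (plane R)) (f u v w : plane R -> R).

(** The measurable sets of the plane are generated by rectangles, so an open set
    is written as a countable union of squares with rational centres and radii. *)
Lemma open_measurable_plane U : open U -> measurable U.
Proof.
move=> oU.
pose B (q r s : rat) : set (plane R) :=
  ball (ratr q : R) (ratr s) `*` ball (ratr r : R) (ratr s).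
pose G q r s := if `[< B q r s `<=` U >] then B q r s else set0.
suff -> : U = \bigcup_q \bigcup_r \bigcup_s G q r s.
  do 3!apply: bigcupT_measurable_rat => ?; rewrite /G; case: ifPn => // _.
  apply: measurableX; apply: open_measurable; exact: ball_open.
apply/seteqP; split => [p Up|p [q _ [r _ [s _]]]]; last first.
  by rewrite /G; case: ifPn => // /asboolP; exact.
have /nbhs_ballP[e /= e0 eU] : nbhs p U by exact: open_nbhs_nbhs.
(* A radius below e / 2 puts every square of that radius containing p in U. *)
have [s] := rat_in_itvoo (divr_gt0 e0 (ltr0n R 2)); rewrite in_itv/= => /andP[s0 se].
have near (x : R) : exists q : rat, ball (ratr q : R) (ratr s) x.
  have /rat_in_itvoo[q] : x - ratr s < x + ratr s by lra.
  by rewrite in_itv/= => q_in; exists q; rewrite /ball/= ltr_norml; lra.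
have [[q pq] [r pr]] := (near p.1, near p.2).
exists q => //; exists r => //; exists s => //.
rewrite /G ifT; first by split.
apply/asboolP => -[x t] [/= xq tr]; apply: eU.
by split => /=; apply: ball_splitr (_ : ball _ _ _) (_ : ball _ _ _);
  first [exact: le_ball (ltW se) _ pq | exact: le_ball (ltW se) _ xq
  | exact: le_ball (ltW se) _ pr | exact: le_ball (ltW se) _ tr].
Qed.

Lemma open_continuous_measurable_plane U f :
  open U -> {in U, continuous f} -> measurable_fun U f.
Proof.
move=> oU cf; apply: (measurability _ (RGenOpens.measurableE R)).
move=> _ [_ [a [b ->] <-]]; apply: open_measurable_plane.
rewrite openE => p [Up fp]; apply: filterI; first exact: open_nbhs_nbhs.
apply: (cf p); first exact/mem_set.
by apply: open_nbhs_nbhs; split => //; exact: interval_open.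
Qed.

(** Functions are only assumed continuous at the points of an open set [U]: the
    coefficients of the surface need not extend continuously beyond the strip. *)
Lemma compact_bounded_plane U K f : open U -> {in U, continuous f} ->
  compact K -> K `<=` U -> exists2 M, 0 <= M & forall p, K p -> `|f p| <= M.
Proof.
move=> oU cf cK KU.
have : compact [set f x | x in K].
  apply: continuous_compact cK; apply: continuous_in_subspaceT => p pK.
  by apply: cf; exact/mem_set/KU/set_mem.
move=> /compact_bounded[M [_ fM]]; exists (`|M| + 1) => // p Kp.
by apply: (fM (`|M| + 1)); [rewrite (le_lt_trans (ler_norm _))// ltrDl|exists p].
Qed.

Lemma compact_closed_plane K : compact K -> closed K.
Proof. by apply: compact_closed; exact: norm_hausdorff. Qed.

Lemma compact_measurable_plane K : compact K -> measurable K.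
Proof.
move=> /compact_closed_plane/closed_openC/open_measurable_plane/measurableC.
by rewrite setCK.
Qed.

Lemma Linfty_loc_continuous U f :
  open U -> {in U, continuous f} -> Linfty_loc U f.
Proof.
move=> oU cf K cK KU.
have mK := compact_measurable_plane _ cK.
have [M M0 fM] := compact_bounded_plane _ _ _ oU cf cK KU.
rewrite inE; apply/andP; split.
  rewrite inE/=; apply/(measurable_restrictT _ _).1 => //.
  apply: measurable_funS (open_continuous_measurable_plane _ _ oU cf) => //.
  exact: open_measurable_plane.
rewrite inE/= /finite_norm unlock; case: ifP => // _.
apply: (@le_lt_trans _ _ M%:E); last exact: ltry.
apply/ess_supP; apply: nearW => p /=; rewrite lee_fin patchE.
by case: ifPn => [/set_mem/fM//|_]; rewrite normr0.
Qed.

Lemma compact_subset_box K : compact K ->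
  exists2 M : R, 0 < M & forall p, K p -> `|p.1| < M /\ `|p.2| < M.
Proof.
move=> /compact_bounded[M [_ KM]]; exists (`|M| + 2); first by rewrite ltr_wpDl.
have KM' p : K p -> `|p| <= `|M| + 1.
  by apply: KM; rewrite (le_lt_trans (ler_norm _))// ltrDl.
by move=> p /KM'; rewrite prod_normE ge_max => /andP[]; lra.
Qed.

Lemma compact_lebesgue2_lty K : compact K -> (lebesgue2 K < +oo)%E.
Proof.
move=> cK; have [M M0 KM] := compact_subset_box _ cK.
pose B : set (plane R) := `[- M, M]%classic `*` `[- M, M]%classic.
have mB : measurable B by apply: measurableX.
apply: (@le_lt_trans _ _ (lebesgue2 B)).
  apply: le_measure; rewrite ?inE//; first exact: compact_measurable_plane.
  by move=> p /KM[p1 p2]; split => /=; rewrite in_itv/= -ler_norml ltW.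
have mI : lebesgue_measure `[- M, M]%classic = (M + M)%:E.
  by rewrite lebesgue_measure_itv/= lte_fin ifT ?opprK//; lra.
by rewrite /B /lebesgue2 product_measure1E//; apply: lte_mul_pinfty;
  rewrite /= mI ?ltry// lee_fin; lra.
Qed.

Lemma integrable_compact_supp f K : continuous f -> compact K ->
  (forall p, ~ K p -> f p = 0) -> lebesgue2.-integrable setT (EFin \o f).
Proof.
move=> cf cK f0.
have mf : measurable_fun setT f.
  by apply: open_continuous_measurable_plane; [exact: openT|move=> p _; exact: cf].
have -> : f = f \_ K.
  by apply/funext => p; rewrite patchE; case: ifPn => // /negP; rewrite inE => /f0.
have mK := compact_measurable_plane _ cK.
rewrite -restrict_EFin.
apply/(@integrable_restrict _ _ _ lebesgue2 _ mK _ measurableT).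
rewrite setTI; apply: measurable_bounded_integrable.
- exact: mK.
- exact: compact_lebesgue2_lty.
- exact: measurable_funS mf.
have cf' : {in [set: plane R], continuous f} by move=> p _; exact: cf.
have [M M0 fM] := compact_bounded_plane setT K f openT cf' cK (fun _ _ => I).
exists M; split; first exact: num_real.
by move=> x Mx p /fM fp; apply: le_trans fp _; exact: ltW.
Qed.

(** The fundamental theorem of calculus on an interval containing the support. *)
Lemma integral_derive_compact_supp (F g : R -> R) (M : R) : 0 < M ->
  continuous g -> (forall t : R, is_derive t 1 F (g t)) ->
  (forall t, M <= `|t| -> F t = 0) -> (forall t, M <= `|t| -> g t = 0) ->
  (\int[lebesgue_measure]_t (g t)%:E = 0)%E.
Proof.
move=> M0 cg dF F0 g0.
have -> : (\int[lebesgue_measure]_t (g t)%:E =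
           \int[lebesgue_measure]_(t in `[(- M)%R, M]) (g t)%:E)%E.
  rewrite [RHS]integral_mkcond; apply: eq_integral => t _.
  rewrite patchE; case: ifPn => // /negP; rewrite inE/= in_itv/= -ler_norml.
  by move=> /negP; rewrite -ltNge => /ltW/g0 ->.
have cF : continuous F.
  by move=> t; apply: differentiable_continuous; apply/derivable1_diffP; case: (dF t).
rewrite (@continuous_FTC2 _ _ F); first last.
- by move=> t _; rewrite derive1E; case: (dF t).
- split; first by move=> t _; case: (dF t).
  + by apply: cvg_at_right_filter; exact: cF.
  + by apply: cvg_at_left_filter; exact: cF.
- exact: continuous_subspaceT.
- by lra.
by rewrite !F0 ?subee// ?normrN ger0_norm// ltW.
Qed.

(** * Integration by parts and weak derivatives *)

Lemma is_derive_axis0 w p a :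
  is_derive p (axis 0) w a <-> is_derive p.1 1 (fun x => w (x, p.2)) a.
Proof.
case: p => x t.
have E : (fun h : R => h^-1 *: ((w \o shift (x, t)) (h *: axis 0) - w (x, t))) =
    (fun h => h^-1 *: (((fun x => w (x, t)) \o shift x) (h *: 1) - w (x, t))).
  apply/funext => h; congr (_ *: (w _ - _)); rewrite /axis eqxx.
  by rewrite /shift/=; congr pair; rewrite /= scaler0 add0r.
by split=> -[dw <-]; split; move: dw; rewrite /derivable /derive/= E.
Qed.

Lemma is_derive_axis1 w p a :
  is_derive p (axis 1) w a <-> is_derive p.2 1 (fun t => w (p.1, t)) a.
Proof.
case: p => x t.
have E : (fun h : R => h^-1 *: ((w \o shift (x, t)) (h *: axis 1) - w (x, t))) =
    (fun h => h^-1 *: (((fun t => w (x, t)) \o shift t) (h *: 1) - w (x, t))).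
  apply/funext => h; congr (_ *: (w _ - _)); rewrite /axis/=.
  by rewrite /shift/=; congr pair; rewrite /= scaler0 add0r.
by split=> -[dw <-]; split; move: dw; rewrite /derivable /derive/= E.
Qed.

(** By Fubini the integral can be taken first along the lines parallel to the
    axis [i], and on each of them it is zero. *)
Lemma integral_partial_compact_supp i w f K : continuous f ->
  (forall p, is_derive p (axis i) w (f p)) ->
  compact K -> (forall p, ~ K p -> w p = 0) -> (forall p, ~ K p -> f p = 0) ->
  (\int[lebesgue2]_p (f p)%:E = 0)%E.
Proof.
move=> cf dw cK w0 f0; have [M M0 KM] := compact_subset_box _ cK.
have intf := integrable_compact_supp _ _ cf cK f0 : (_ \x _)%E.-integrable _ _.
have out (g : plane R -> R) p : (forall p, ~ K p -> g p = 0) ->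
    M <= `|p.1| \/ M <= `|p.2| -> g p = 0.
  by move=> g0 Mp; apply: g0 => /KM; case: Mp; lra.
have [i0|i1] := eqVneq i 0.
  apply: etrans (esym (integral21_prod_meas1 intf)) _; apply: integral0_eq => t _.
  apply: (integral_derive_compact_supp (fun x => w (x, t)) _ M M0).
  - move=> x; apply: (@continuous_comp _ _ _ (fun x => (x, t)) f); last exact: cf.
    by apply: (@cvg_pair _ _ _ _ (nbhs x) (nbhs t)); [exact: cvg_id|exact: cvg_cst].
  - by move=> x; apply/(is_derive_axis0 w (x, t)); rewrite -i0.
  - by move=> x Mx; apply: out => //; left.
  - by move=> x Mx; apply: out => //; left.
have {}i1 : i = 1 by move: i1; case: i {dw} => -[|[|]]// ? _; exact/val_inj.
apply: etrans (esym (integral12_prod_meas1 intf)) _; apply: integral0_eq => x _.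
apply: (integral_derive_compact_supp (fun t => w (x, t)) _ M M0).
- move=> t; apply: (@continuous_comp _ _ _ (fun t => (x, t)) f); last exact: cf.
  by apply: (@cvg_pair _ _ _ _ (nbhs x) (nbhs t)); [exact: cvg_cst|exact: cvg_id].
- by move=> t; apply/(is_derive_axis1 w (x, t)); rewrite -i1.
- by move=> t Mt; apply: out => //; right.
- by move=> t Mt; apply: out => //; right.
Qed.

Lemma supp0 f p : ~ supp f p -> f p = 0.
Proof.
by move=> Nfp; apply/eqP; apply: contra_notT Nfp => fp; exact: subset_closure.
Qed.

Lemma partial_supp0 i f p : ~ supp f p -> partial i f p = 0.
Proof.
move=> Nfp; have D0 : 'D_(axis i) (cst (0 : R)) p = 0 by rewrite derive_cst.
rewrite /partial -[RHS]D0; apply: near_eq_derive.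
have : nbhs p (~` supp f).
  by apply: open_nbhs_nbhs; split => //; apply/closed_openC/closed_closure.
by apply: filterS => q /supp0.
Qed.

Lemma smooth_continuous f : smooth f -> continuous f.
Proof. by move=> sf p; apply: differentiable_continuous (sf [::] p). Qed.

Lemma smooth_continuous_partial i f : smooth f -> continuous (partial i f).
Proof. by move=> sf p; apply: differentiable_continuous (sf [:: i] p). Qed.

Lemma smooth_is_derive i f p : smooth f ->
  is_derive p (axis i) f (partial i f p).
Proof. by move=> sf; split => //; apply: diff_derivable (sf [::] p). Qed.

Lemma restrict_near U f p : open U -> U p -> {near p, f =1 f \_ U}.
Proof.
move=> oU Up; have : nbhs p U by exact: open_nbhs_nbhs.
by apply: filterS => q Uq; rewrite patchE mem_set.
Qed.

Lemma restrict_near0 U K f p : compact K -> (forall q, ~ K q -> f q = 0) ->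
  ~ K p -> {near p, cst 0 =1 f \_ U}.
Proof.
move=> cK f0 NKp; have : nbhs p (~` K).
  by apply: open_nbhs_nbhs; split => //; exact/closed_openC/(compact_closed_plane K).
by apply: filterS => q NKq; rewrite patchE; case: ifP => // _; rewrite f0.
Qed.

(** Multiplying by a factor with compact support in [U] turns continuity on [U]
    into continuity of the extension by zero, because the plane is covered by the
    open sets [U] and [~` K]. *)
Lemma continuous_restrict_supp U K f v : open U -> {in U, continuous f} ->
  compact K -> K `<=` U -> continuous v -> (forall p, ~ K p -> v p = 0) ->
  continuous ((fun p => f p * v p) \_ U).
Proof.
move=> oU cf cK KU cv v0 p.
have [Kp|NKp] := pselect (K p).
  have Up := KU _ Kp.
  have near_p := restrict_near U (fun p => f p * v p) p oU Up.
  rewrite /continuous_at patchE mem_set//.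
  apply: cvg_trans (near_eq_cvg near_p) _; apply: cvgM; last exact: cv.
  by apply: cf; exact/mem_set.
have fv0 q : ~ K q -> f q * v q = 0 by move=> /v0 ->; rewrite mulr0.
have near_p := restrict_near0 U K (fun p => f p * v p) p cK fv0 NKp.
rewrite /continuous_at patchE fv0// if_same.
exact: cvg_trans (near_eq_cvg near_p) (cvg_cst _).
Qed.

(** The product of [u] with a test function, extended by zero, is differentiable
    along the axis [i] at every point of the plane; its derivative is continuous
    with compact support, hence has integral zero, and the product rule splits
    that integral into the two sides of the definition of a weak derivative. *)
Lemma weak_partial_of_partial U i u v : open U ->
  {in U, continuous u} -> {in U, continuous v} ->
  (forall p, U p -> is_derive p (axis i) u (v p)) -> weak_partial U i u v.
Proof.
move=> oU cu cv du phi [sphi cK KU]; rewrite /dpartial /of_fun.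
set K := supp phi in cK KU.
pose f := (fun p => v p * phi p) \_ U.
pose g := (fun p => u p * partial i phi p) \_ U.
have cf : continuous f.
  apply: continuous_restrict_supp cv cK KU _ _ => //.
  - exact: smooth_continuous.
  - exact: supp0.
have cg : continuous g.
  apply: continuous_restrict_supp cu cK KU _ _ => //.
  - exact: smooth_continuous_partial.
  - exact: partial_supp0.
have f0 p : ~ K p -> f p = 0.
  by move=> /supp0 E; rewrite /f patchE E mulr0 if_same.
have g0 p : ~ K p -> g p = 0.
  by move=> /partial_supp0 E; rewrite /g patchE E mulr0 if_same.
have dw p : is_derive p (axis i) ((fun p => u p * phi p) \_ U) (f p + g p).
  have [Kp|NKp] := pselect (K p).
    have Up := KU _ Kp.
    have near_p := restrict_near U (fun p => u p * phi p) p oU Up.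
    apply: near_eq_is_derive near_p _.
    have dup := du _ Up; have dphi := smooth_is_derive i phi p sphi.
    apply: is_derive_eq; rewrite /f /g !patchE mem_set//.
    by rewrite /GRing.scale/= addrC mulrC [u p * _]mulrC.
  rewrite f0// g0// addr0.
  apply: (@near_eq_is_derive _ _ _ (cst 0)).
    by apply: (restrict_near0 U K) => // q /supp0 ->; rewrite mulr0.
have intf := integrable_compact_supp _ _ cf cK f0.
have intg := integrable_compact_supp _ _ cg cK g0.
apply/esym/eqP; rewrite -addr_eq0; apply/eqP.
have -> : \int[lebesgue2]_(p in U) (v p * phi p) = \int[lebesgue2]_p f p.
  exact: Rintegral_mkcond.
have -> : \int[lebesgue2]_(p in U) (u p * partial i phi p) =
    \int[lebesgue2]_p g p by exact: Rintegral_mkcond.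
rewrite -RintegralD// /Rintegral.
rewrite (integral_partial_compact_supp i _ (fun p => f p + g p) K _ dw)//.
- by move=> p; apply: cvgD; [exact: cf|exact: cg].
- by move=> p /supp0 E; rewrite patchE E mulr0 if_same.
- by move=> p NKp; rewrite f0// g0// addr0.
Qed.

Lemma continuous_fun_snd (f : R -> R) (p : plane R) :
  {for p.2, continuous f} -> {for p, continuous (fun q : plane R => f q.2)}.
Proof. by move=> cf; apply: (continuous_comp _ cf); exact: cvg_snd. Qed.

Lemma continuous_fun_fst (f : R -> R) (p : plane R) :
  {for p.1, continuous f} -> {for p, continuous (fun q : plane R => f q.1)}.
Proof. by move=> cf; apply: (continuous_comp _ cf); exact: cvg_fst. Qed.

Lemma continuous_tensor (f g : R -> R) (p : plane R) :
  {for p.1, continuous f} -> {for p.2, continuous g} ->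
  {for p, continuous (fun q : plane R => f q.1 * g q.2)}.
Proof.
move=> cf cg.
by apply: continuousM; [exact: continuous_fun_fst|exact: continuous_fun_snd].
Qed.

Lemma is_derive_continuous (f : R -> R) (x df : R) :
  is_derive x 1 f df -> {for x, continuous f}.
Proof.
by case=> dfx _; apply: differentiable_continuous; exact/derivable1_diffP.
Qed.

(** The components of the immersion are products [f x * g t], for which the
    partial derivatives are ordinary derivatives of one factor. *)
Lemma weak_partial0_tensor U (f df g : R -> R) : open U ->
  continuous df -> (forall x : R, is_derive x 1 f (df x)) ->
  (forall p, U p -> {for p.2, continuous g}) ->
  weak_partial U 0 (fun p => f p.1 * g p.2) (fun p => df p.1 * g p.2).
Proof.
move=> oU cdf dfE cg; apply: weak_partial_of_partial => // [p|p|p Up].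
- move=> /set_mem Up; apply: continuous_tensor; last exact: cg.
  exact: is_derive_continuous (dfE p.1).
- by move=> /set_mem Up; apply: continuous_tensor; [exact: cdf|exact: cg].
- apply/is_derive_axis0; have dfx := dfE p.1.
  have dc := is_derive_cst (g p.2) p.1 (1 : R).
  by apply: is_derive_eq (is_deriveM dfx dc) _; rewrite /GRing.scale/=; ring.
Qed.

Lemma weak_partial1_tensor U (f g dg : R -> R) : open U -> continuous f ->
  (forall p, U p -> {for p.2, continuous dg}) ->
  (forall p, U p -> is_derive p.2 1 g (dg p.2)) ->
  weak_partial U 1 (fun p => f p.1 * g p.2) (fun p => f p.1 * dg p.2).
Proof.
move=> oU cf cdg dgE; apply: weak_partial_of_partial => // [p|p|p Up].
- move=> /set_mem Up; apply: continuous_tensor; first exact: cf.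
  exact: is_derive_continuous (dgE p Up).
- by move=> /set_mem Up; apply: continuous_tensor; [exact: cf|exact: cdg].
- apply/is_derive_axis1; have dgx := dgE p Up.
  have dc := is_derive_cst (f p.1) p.2 (1 : R).
  by apply: is_derive_eq (is_deriveM dc dgx) _; rewrite /GRing.scale/=; ring.
Qed.

Lemma eq_of_fun U u v phi : (forall p, U p -> u p = v p) ->
  of_fun U u phi = of_fun U v phi.
Proof. by move=> uv; apply: eq_Rintegral => p /set_mem/uv ->. Qed.

Lemma of_fun0 U phi : of_fun U (cst 0) phi = 0.
Proof.
by rewrite /of_fun /Rintegral integral0_eq//= => p _; rewrite mul0r.
Qed.

End Analysis.

(** * Vectors of R^3 in coordinates *)

Section Vectors.
Context {R : realType}.

Definition row3 (x y z : R) : 'rV[R]_3 := \row_k [:: x; y; z]`_k.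

Lemma dot3_row3 x y z x' y' z' :
  dot3 (row3 x y z) (row3 x' y' z') = x * x' + y * y' + z * z'.
Proof. by rewrite /dot3 !big_ord_recl big_ord0 !mxE/= addr0 addrA. Qed.

Lemma cross3_row3 x y z x' y' z' : cross3 (row3 x y z) (row3 x' y' z') =
  row3 (y * z' - z * y') (z * x' - x * z') (x * y' - y * x').
Proof. by apply/rowP => -[[|[|[|]]]]//= k3; rewrite !mxE. Qed.

Lemma scale_row3 c x y z : c *: row3 x y z = row3 (c * x) (c * y) (c * z).
Proof. by apply/rowP => -[[|[|[|]]]]//= k3; rewrite !mxE. Qed.

End Vectors.

(** * Surfaces of revolution *)

Lemma ord2_cases (i : 'I_2) : i = 0 \/ i = 1.
Proof. by case: i => -[|[|//]] i2; [left|right]; exact: val_inj. Qed.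

Section SurfaceOfRevolution.
Context {R : realType} (a : R) (h h1 h2 z zeta zeta1 : R -> R).
Implicit Types (n m : nat) (p : plane R).

(** [angular n x] and [radial m t] list, for the three coordinates of the
    immersion, the [n]-th derivative of the factor depending on [x] and the [m]-th
    derivative of the factor depending on [t]; only orders up to two are
    meaningful, larger ones repeating the order two.  The symbols [h1], [h2],
    [zeta], [zeta1] stand for h', h'', z', z''. *)
Definition angular n (x : R) : seq R :=
  match n with
  | 0 => [:: a * cos (x / a); a * sin (x / a); 1]
  | 1 => [:: - sin (x / a); cos (x / a); 0]
  | _ => [:: - (cos (x / a) / a); - (sin (x / a) / a); 0]
  end.

Definition radial m (t : R) : seq R :=
  match m with
  | 0 => [:: h t; h t; z t]
  | 1 => [:: h1 t; h1 t; zeta t]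
  | _ => [:: h2 t; h2 t; zeta1 t]
  end.

(** The derivative of order [n] in [x] and [m] in [t] of the immersion, so that a
    derivation in direction [i] adds [i == 0] to [n] and [i == 1] to [m]. *)
Definition surf n m p : 'rV[R]_3 :=
  \row_k ((angular n p.1)`_k * (radial m p.2)`_k).

Definition surf1 (i : 'I_2) := surf (i == 0) (i == 1).

Definition surf2 (i j : 'I_2) := surf ((j == 0) + (i == 0)) ((j == 1) + (i == 1)).

Definition fundamental2 p : 'M[R]_2 :=
  \matrix_(i, j) if i != j then 0 else
    if i == 0 then - (h p.2 * zeta p.2 / a) else a * h2 p.2 / zeta p.2.

Lemma surfE n m p : let A := angular n p.1 in let B := radial m p.2 in
  surf n m p = row3 (A`_0 * B`_0) (A`_1 * B`_1) (A`_2 * B`_2).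
Proof. by apply/rowP => -[[|[|[|]]]]//= k3; rewrite !mxE. Qed.

Lemma continuous_angular n k : continuous (fun x => (angular n x)`_k).
Proof.
have cxa x : {for x, continuous (fun x : R => x / a)}.
  by apply: continuousM; [exact: cvg_id|exact: cvg_cst].
have cc : continuous (fun x : R => cos (x / a)).
  by move=> x; apply: (continuous_comp (cxa x) (@continuous_cos R _)).
have cs : continuous (fun x : R => sin (x / a)).
  by move=> x; apply: (continuous_comp (cxa x) (@continuous_sin R _)).
case: n k => [|[|n]] [|[|[|k]]] x /=; rewrite ?nth_nil; try exact: cvg_cst.
- by apply: continuousM; [exact: cvg_cst|exact: cc].
- by apply: continuousM; [exact: cvg_cst|exact: cs].
- by apply: cvgN; exact: cs.
- exact: cc.
- by apply: cvgN; apply: cvgM; [exact: cc|exact: cvg_cst].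
- by apply: cvgN; apply: cvgM; [exact: cs|exact: cvg_cst].
Qed.

Lemma is_derive_angular n k (x : R) : a != 0 -> (n < 2)%N ->
  is_derive x 1 (fun x => (angular n x)`_k) ((angular n.+1 x)`_k).
Proof.
move=> a0; case: n k => [|[|//]] [|[|[|k]]] _ /=; rewrite ?nth_nil;
  try exact: is_derive_cst.
- by apply: is_derive_eq; rewrite /GRing.scale/=; field.
- by apply: is_derive_eq; rewrite /GRing.scale/=; field.
- by apply: is_derive_eq; rewrite /GRing.scale/=; field.
- by apply: is_derive_eq; rewrite /GRing.scale/=; field.
Qed.

(** The vector [d_1 y] has length [h] and is orthogonal to the unit vector [d_2 y],
    so the cross product has length [h] too and the normalisation is a division
    by [h]. *)
Lemma surf_fundamental_forms p : a != 0 -> 0 < h p.2 -> zeta p.2 != 0 ->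
  zeta p.2 ^+ 2 = 1 - (a * h1 p.2) ^+ 2 ->
  zeta1 p.2 = - (a ^+ 2 * h1 p.2 * h2 p.2 / zeta p.2) ->
  forall i j : 'I_2, metric h p i j = dot3 (surf1 i p) (surf1 j p) /\
    fundamental2 p i j = dot3 (surf2 i j p) (unit_normal (surf1 0 p) (surf1 1 p)).
Proof.
move=> a0 h_gt0 z0 zE z1E.
pose c := cos (p.1 / a); pose s := sin (p.1 / a).
have cs : c ^+ 2 + s ^+ 2 = 1 by exact: cos2Dsin2.
set H := h p.2 in h_gt0 *; set H1 := h1 p.2 in zE z1E *.
set H2 := h2 p.2 in z1E *; set Z := zeta p.2 in z0 zE z1E *.
have N : unit_normal (surf1 0 p) (surf1 1 p) =
    row3 (c * Z) (s * Z) (- (a * H1)).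
  pose X := H *: row3 (c * Z) (s * Z) (- (a * H1)).
  have -> : unit_normal (surf1 0 p) (surf1 1 p) = (enorm3 X)^-1 *: X.
    rewrite /X /unit_normal /surf1 !surfE/= cross3_row3 scale_row3.
    rewrite -/c -/s -/H -/H1 -/Z.
    suff -> : row3 (c * H * (1 * Z) - 0 * z p.2 * (a * s * H1))
        (0 * z p.2 * (a * c * H1) - - s * H * (1 * Z))
        (- s * H * (a * s * H1) - c * H * (a * c * H1)) =
      row3 (H * (c * Z)) (H * (s * Z)) (H * - (a * H1)) by [].
    congr row3; [by ring|by ring|].
    by rewrite -[in RHS](mul1r (- _)) -cs; ring.
  have -> : enorm3 X = H.
    rewrite /X /enorm3 scale_row3 dot3_row3.
    rewrite (_ : _ + _ = H ^+ 2 * ((c ^+ 2 + s ^+ 2) * Z ^+ 2 + (a * H1) ^+ 2)).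
      by rewrite cs mul1r zE subrK mulr1 sqrtr_sqr gtr0_norm.
    by ring.
  by rewrite /X scalerA mulVf ?gt_eqF// scale1r.
move=> i j; rewrite N; have [->|->] := ord2_cases i; have [->|->] := ord2_cases j;
  rewrite !mxE /surf1 /surf2 !surfE/= !dot3_row3 -/c -/s -/H -/H1 -/H2 -/Z.
- split; first by rewrite -[LHS]mulr1 -cs; ring.
  by rewrite -[LHS]mulr1 -cs; ring.
- by split; ring.
- by split; ring.
- split.
    rewrite (_ : _ + _ = (c ^+ 2 + s ^+ 2) * (a * H1) ^+ 2 + Z ^+ 2); last by ring.
    by rewrite cs zE mul1r addrC subrK.
  rewrite z1E (_ : _ + _ =
    a * H2 / Z * ((c ^+ 2 + s ^+ 2) * Z ^+ 2 + (a * H1) ^+ 2)); last by field.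
  by rewrite cs mul1r zE subrK mulr1.
Qed.

Context (U : set (plane R)) (openU : open U) (a_neq0 : a != 0).
Context (radial_continuous : forall p m k, U p ->
  {for p.2, continuous (fun t => (radial m t)`_k)}).
Context (radial_derive : forall p m k, U p -> (m < 2)%N ->
  is_derive p.2 1 (fun t => (radial m t)`_k) ((radial m.+1 p.2)`_k)).

Lemma W2infty_loc_surf : W2infty_loc U (surf 0 0) surf1 surf2.
Proof.
move=> k.
have E n m : (fun p => surf n m p 0 k) =
    (fun p => (angular n p.1)`_k * (radial m p.2)`_k).
  by apply/funext => q; rewrite mxE.
have L n m : Linfty_loc U (fun p => surf n m p 0 k).
  rewrite E; apply: Linfty_loc_continuous => // p /set_mem Up.
  apply: (continuous_tensor (fun x => (angular n x)`_k) (fun t => (radial m t)`_k)).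
    exact: continuous_angular.
  exact: radial_continuous.
have W (i : 'I_2) n m : (n < 2)%N -> (m < 2)%N -> weak_partial U i
    (fun p => surf n m p 0 k) (fun p => surf (n + (i == 0)) (m + (i == 1)) p 0 k).
  move=> n2 m2.
  rewrite !E; have [->|->] := ord2_cases i; rewrite /= addn0 addn1 => {i}.
    apply: (weak_partial0_tensor U (fun x => (angular n x)`_k)
      (fun x => (angular n.+1 x)`_k) (fun t => (radial m t)`_k)) => //.
      exact: continuous_angular.
      by move=> x; exact: is_derive_angular.
    by move=> p Up; exact: radial_continuous.
  apply: (weak_partial1_tensor U (fun x => (angular n x)`_k)
    (fun t => (radial m t)`_k) (fun t => (radial m.+1 t)`_k)) => //.
    exact: continuous_angular.
    by move=> p Up; exact: radial_continuous.
  by move=> p Up; exact: radial_derive.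
split.
- exact: L.
- by move=> i; exact: L.
- by move=> i j; exact: L.
- by move=> i; exact: (W i 0%N 0%N).
- by move=> i j; apply: W; [case: (j == 0)|case: (j == 1)].
Qed.

Context (zeta_neq0 : forall p, U p -> zeta p.2 != 0).

Lemma Linfty_loc_fundamental2 i j : Linfty_loc U (fun p => fundamental2 p i j).
Proof.
apply: Linfty_loc_continuous => // p /set_mem Up.
have cz : {for p.2, continuous zeta} := radial_continuous p 1%N 2%N Up.
have -> : (fun p => fundamental2 p i j) = (fun p => if i != j then 0 else
    if i == 0 then - (h p.2 * zeta p.2 / a) else a * h2 p.2 / zeta p.2).
  by apply/funext => q; rewrite mxE.
case: (i != j); first exact: cvg_cst.
case: (i == 0).
  apply: (@continuous_fun_snd _ (fun t => - (h t * zeta t / a))).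
  apply: cvgN; apply: cvgM; last exact: cvg_cst.
  by apply: cvgM cz; exact: radial_continuous p 0%N 0%N Up.
apply: (@continuous_fun_snd _ (fun t => a * h2 t / zeta t)).
apply: cvgM; last by apply: cvgV cz; exact: zeta_neq0.
by apply: cvgM; [exact: cvg_cst|exact: radial_continuous p 2%N 0%N Up].
Qed.

(** The second Codazzi equation only says that [a * h2 / zeta] is independent of
    [x].  The first one is the product rule for [h * zeta], the derivative of
    [zeta] being the one prescribed by [zeta^2 = 1 - (a * h')^2]. *)
Lemma Gauss_Codazzi_fundamental2 (k : R -> R) : h^`() = h1 ->
  (forall p, U p -> 0 < h p.2) -> (forall p, U p -> h2 p.2 = k p.2 * h p.2) ->
  (forall p, U p -> zeta1 p.2 = - (a ^+ 2 * h1 p.2 * h2 p.2 / zeta p.2)) ->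
  Gauss_Codazzi U k h fundamental2.
Proof.
move=> h1E h_gt0 h2E zeta1E; rewrite /Gauss_Codazzi h1E.
have b12 : (fun p => fundamental2 p 0 1) = cst 0.
  by apply/funext => p; rewrite mxE.
have b11 : (fun p => fundamental2 p 0 0) = (fun p => - (h p.2 * zeta p.2 / a)).
  by apply/funext => p; rewrite mxE.
have b22 : (fun p => fundamental2 p 1 1) = (fun p => a * h2 p.2 / zeta p.2).
  by apply/funext => p; rewrite mxE.
split=> phi tphi.
- rewrite /dsub; rewrite b12 {2}/dpartial of_fun0 oppr0 subr0 b11.
  pose dg t := - ((h1 t * zeta t + h t * zeta1 t) / a).
  have db11 p : U p ->
      is_derive p.2 1 (fun t => - (h t * zeta t / a)) (dg p.2).
    move=> Up; have dh : is_derive p.2 1 h (h1 p.2) := radial_derive p 0%N 0%N Up isT.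
    have dz : is_derive p.2 1 zeta (zeta1 p.2) := radial_derive p 1%N 2%N Up isT.
    by apply: is_derive_eq; rewrite /dg /GRing.scale/=; ring.
  transitivity (of_fun U (fun p => dg p.2) phi).
    apply: weak_partial_of_partial tphi => // [p|p|p Up].
    + move=> /set_mem Up.
      apply: (@continuous_fun_snd _ (fun t => - (h t * zeta t / a))).
      exact: is_derive_continuous (db11 _ Up).
    + move=> /set_mem Up; apply: (@continuous_fun_snd _ dg).
      apply: cvgN; apply: cvgM; last exact: cvg_cst.
      apply: cvgD; apply: cvgM.
      * exact: radial_continuous p 1%N 0%N Up.
      * exact: radial_continuous p 1%N 2%N Up.
      * exact: radial_continuous p 0%N 0%N Up.
      * exact: radial_continuous p 2%N 2%N Up.
    + exact/is_derive_axis1/db11.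
  apply: eq_of_fun => p Up; rewrite !mxE/= /dg zeta1E//.
  by field; rewrite a_neq0 zeta_neq0// gt_eqF// h_gt0.
- rewrite /dsub b12 b22 {1}/dpartial of_fun0 oppr0 sub0r.
  transitivity (0 : R); last first.
    rewrite -[LHS](of_fun0 U phi); apply: eq_of_fun => p _.
    by rewrite mxE/= oppr0 mul0r.
  pose f t := a * h2 t / zeta t.
  have -> : (fun p => a * h2 p.2 / zeta p.2) = (fun p => cst 1 p.1 * f p.2).
    by apply/funext => p; rewrite mul1r.
  have W : weak_partial U 0 (fun p => cst 1 p.1 * f p.2) (fun p => cst 0 p.1 * f p.2).
    apply: (weak_partial0_tensor U (cst 1) (cst 0) f) => //.
    + by move=> x; exact: cvg_cst.
    + move=> p Up; apply: cvgM; last first.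
        by apply: cvgV; [exact: zeta_neq0|exact: radial_continuous p 1%N 2%N Up].
      by apply: cvgM; [exact: cvg_cst|exact: radial_continuous p 2%N 0%N Up].
  rewrite (W phi tphi) -[RHS]oppr0; congr (- _); rewrite -[RHS](of_fun0 U phi).
  by apply: eq_of_fun => p _; exact: mul0r.
- apply: eq_of_fun => p Up; rewrite !mxE/= h2E//.
  by field; rewrite a_neq0 zeta_neq0.
Qed.

End SurfaceOfRevolution.

(** * The immersion of the strip *)

Lemma continuous_kstar (R : realType) (delta C : R) : continuous (kstar delta C).
Proof.
move=> t; have t1 (u : R) : 0 < 1 + `|u| by rewrite ltr_pwDl.
have E : kstar delta C = (fun t => C * (expR ((2 + delta / 2) * ln (1 + `|t|)))^-1).
  by apply/funext => u; rewrite /kstar /powR gt_eqF.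
rewrite E; apply: cvgM; first exact: cvg_cst.
apply: cvgV; first by rewrite gt_eqF ?expR_gt0.
have cl : {for t, continuous (fun t : R => (2 + delta / 2) * ln (1 + `|t|))}.
  apply: cvgM; first exact: cvg_cst.
  have cn : {for t, continuous (fun t : R => 1 + `|t|)}.
    by apply: cvgD; [exact: cvg_cst|exact: norm_continuous].
  exact: (continuous_comp cn (continuous_ln (t1 t))).
exact: (continuous_comp cl (@continuous_expR R _)).
Qed.

Lemma continuous_primitive (R : realType) (f : R -> R) (s : R) : continuous f ->
  exists F : R -> R, forall t, s < t -> is_derive t 1 F (f t).
Proof.
move=> cf; exists (fun x => \int[lebesgue_measure]_(t in `[s, x]) f t) => t st.
have [|||dF F'] := @continuous_FTC1 R f (BLeft s) t (t + 1) _ _ _ (cf t).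
- by rewrite ltrDl.
- apply: continuous_compact_integrable; first exact: segment_compact.
  exact: continuous_subspaceT.
- by rewrite /= lte_fin.
by split => //; rewrite -derive1E.
Qed.

Theorem theorem6p2 (R : realType) (delta C : R)
    (delta_gt0 : 0 < delta) (delta_lt4 : delta < 4) (C_gt0 : 0 < C)
    (h : R -> R) (h_gt0 : forall t, 0 < h t)
    (h_ode : metric_ode (kstar delta C) h) :
  exists2 T0 : R, 0 < T0 & forall T1 T2 : R, T0 < T1 -> T1 < T2 ->
  exists (b : plane R -> 'M[R]_2) (y : plane R -> 'rV[R]_3)
         (D : 'I_2 -> plane R -> 'rV[R]_3)
         (D2 : 'I_2 -> 'I_2 -> plane R -> 'rV[R]_3),
    [/\ forall p, Omega T1 T2 p -> (b p)^T = b p,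
        forall i j, Linfty_loc (Omega T1 T2)° (fun p => b p i j),
        Gauss_Codazzi (Omega T1 T2)° (kstar delta C) h b,
        W2infty_loc (Omega T1 T2)° y D D2 &
        {ae lebesgue2, forall p, Omega T1 T2 p -> forall i j : 'I_2,
          metric h p i j = dot3 (D i p) (D j p) /\
          b p i j = dot3 (D2 i j p) (unit_normal (D 0 p) (D 1 p))}].
Proof.
have [dh dh1 ode _ _] := h_ode.
exists 1 => // T1 T2 _ _; set k := kstar delta C in ode *.
have ck : continuous k := continuous_kstar R delta C.
pose h1 := h^`(); pose h2 t := k t * h t.
have h_derive (t : R) : is_derive t 1 h (h1 t).
  by rewrite /h1 derive1E; exact: derivableP.
have h1_derive (t : R) : is_derive t 1 h1 (h2 t).
  by rewrite /h2 -ode derive1E; exact: derivableP.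
have ch t : {for t, continuous h} by exact: is_derive_continuous (h_derive t).
have ch1 t : {for t, continuous h1} by exact: is_derive_continuous (h1_derive t).
have ch2 t : {for t, continuous h2} by apply: cvgM; [exact: ck|exact: ch].
have [a a_gt0 ah1] : exists2 a, 0 < a &
    forall t, T1 <= t <= T2 -> (a * h1 t) ^+ 2 < 1.
  have : compact [set h1 t | t in `[T1, T2]].
    apply: continuous_compact; last exact: segment_compact.
    by apply: continuous_subspaceT => t; exact: ch1.
  (* |h'| <= N on the strip; dividing by N + 1 makes a |h'| < 1 strict. *)
  move=> /compact_bounded[M [_ h1M]]; pose N := `|M| + 1.
  have N1_gt0 : 0 < N + 1 by rewrite /N -addrA ltr_wpDl.
  have {}h1M t : T1 <= t <= T2 -> `|h1 t| <= N.
    move=> t12; apply: (h1M N); last by exists t => //=; rewrite in_itv.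
    by rewrite (le_lt_trans (ler_norm _))// ltrDl.
  exists (N + 1)^-1; first by rewrite invr_gt0.
  move=> t /h1M h1N; rewrite -[ltLHS]real_normK ?num_real//.
  rewrite expr_lt1// normrM gtr0_norm ?invr_gt0//.
  by rewrite ltr_pdivrMl// mulr1 (le_lt_trans h1N)// ltrDl.
have a_neq0 : a != 0 by rewrite gt_eqF.
pose zeta t := Num.sqrt (1 - (a * h1 t) ^+ 2).
pose zeta1 t := - (a ^+ 2 * h1 t * h2 t / zeta t).
have czeta : continuous zeta.
  move=> t; have cq : {for t, continuous (fun t => 1 - (a * h1 t) ^+ 2)}.
    apply: cvgB; first exact: cvg_cst.
    by apply: cvgM; (apply: cvgM; [exact: cvg_cst|exact: ch1]).
  exact: (continuous_comp cq (@sqrt_continuous R _)).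
(* Integrating from T1 - 1 makes z differentiable at t = T1 as well. *)
have [z dz] := continuous_primitive R zeta (T1 - 1) czeta.
have zeta_sqr t : T1 <= t <= T2 -> zeta t ^+ 2 = 1 - (a * h1 t) ^+ 2.
  by move=> /ah1 lt1; rewrite sqr_sqrtr// subr_ge0 ltW.
have zeta_neq0 t : T1 <= t <= T2 -> zeta t != 0.
  by move=> /ah1 lt1; rewrite gt_eqF// sqrtr_gt0 subr_gt0.
have zeta_derive (t : R) : T1 <= t <= T2 -> is_derive t 1 zeta (zeta1 t).
  move=> tI; pose q t := 1 - (a * h1 t) ^+ 2.
  have q_gt0 : 0 < q t by rewrite subr_gt0 ah1.
  have dq : is_derive t 1 q (- (2 * a ^+ 2 * h1 t * h2 t)).
    by apply: is_derive_eq; rewrite /GRing.scale/=; ring.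
  have D : is_derive t 1 zeta _ :=
    is_derive1_comp (f := Num.sqrt) (g := q) (is_derive1_sqrt q_gt0) dq.
  apply: is_derive_eq D _; rewrite -/(zeta t).
  by rewrite /zeta1; field; rewrite zeta_neq0.
pose U := (Omega T1 T2)°.
have UI p : U p -> T1 <= p.2 <= T2 by move=> /interior_subset.
have cB p m n : U p ->
    {for p.2, continuous (fun t => (radial h h1 h2 z zeta zeta1 m t)`_n)}.
  move=> /UI pI; case: m n => [|[|m]] [|[|[|n]]] /=; rewrite ?nth_nil;
    try solve [exact: cvg_cst|exact: ch|exact: ch1|exact: ch2|exact: czeta].
  - by apply: is_derive_continuous (dz _ _); lra.
  - apply: cvgN; apply: cvgM; last first.
      by apply: cvgV; [exact: zeta_neq0|exact: czeta].
    apply: cvgM; last exact: ch2.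
    by apply: cvgM; [exact: cvg_cst|exact: ch1].
have dB p m n : U p -> (m < 2)%N ->
    is_derive p.2 1 (fun t => (radial h h1 h2 z zeta zeta1 m t)`_n)
      ((radial h h1 h2 z zeta zeta1 m.+1 p.2)`_n).
  move=> /UI pI; case: m n => [|[|//]] [|[|[|n]]] _ /=; rewrite ?nth_nil//;
    try exact: is_derive_cst.
  - by apply: dz; lra.
  - exact: zeta_derive.
exists (fundamental2 a h h2 zeta), (surf a h h1 h2 z zeta zeta1 0 0),
  (surf1 a h h1 h2 z zeta zeta1), (surf2 a h h1 h2 z zeta zeta1).
have oU : open U by exact: open_interior.
have z0 p : U p -> zeta p.2 != 0 by move=> /UI; exact: zeta_neq0.
split.
- move=> p _; apply/matrixP => i j; rewrite !mxE eq_sym.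
  by case: eqVneq => // ->.
- by move=> i j; exact: (Linfty_loc_fundamental2 _ _ _ _ z _ zeta1 _ oU cB).
- exact: (Gauss_Codazzi_fundamental2 _ _ _ _ z _ zeta1 _ oU a_neq0 cB dB).
- exact: W2infty_loc_surf.
- apply: aeW => p pI; apply: surf_fundamental_forms => //.
  + exact: zeta_neq0.
  + exact: zeta_sqr.
Qed.
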